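(* Let $\mathcal{V}\subseteq M_n(\mathbb{K})$ be a non-singular subspace of matrices which satisfies the Commutativity Property. Then the following are equivalent: (a) $\mathcal{V}$ satisfies the Diagonalisability Property; (b) for every non-singular matrix $A\in\mathcal{V}$, the matrices in $A^{-1}\mathcal{V}$ are simultaneously diagonalisable.
   Context: $\mathbb{K}\in\{\mathbb{R},\mathbb{C}\}$; diagonalisability is over $\mathbb{K}$ (by similarity). A subspace of matrices is non-singular if it contains an invertible matrix. A non-singular subspace $\mathcal{V}$ satisfies the Commutativity Property if there exists an invertible $A\in\mathcal{V}$ such that $A^{-1}\mathcal{V}=\{A^{-1}M:M\in\mathcal{V}\}$ is a commuting subspace; it satisfies the Diagonalisability Property if there exists an invertible $B\in\mathcal{V}$ such that all matrices in $B^{-1}\mathcal{V}$ are diagonalisable. *)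

(* Defs.v *)
From mathcomp Require Import all_boot all_order all_algebra.
From mathcomp Require Import reals complex.

Set Implicit Arguments.
Unset Strict Implicit.
Unset Printing Implicit Defensive.

Import GRing.Theory.
Local Open Scope ring_scope.

Variant scalar_kind := RealScalars | ComplexScalars.

Definition scalars (R : realType) (k : scalar_kind) : fieldType :=
  match k with
  | RealScalars => R
  | ComplexScalars => R[i]%C
  end.

Section MatrixSubspaces.
Variables (K : fieldType) (n : nat).
Implicit Types (V W : {vspace 'M[K]_n}) (A : 'M[K]_n).

Definition nonsingular_space V : Prop := exists2 A, A \in V & A \in unitmx.

(* A^-1 V = {A^-1 M : M in V}; the intended meaning requires A \in unitmx,
   since invmx A = A otherwise. *)
Definition lquot A V : {vspace 'M[K]_n} := (linfun (mulmx (invmx A)) @: V)%VS.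

Definition commuting_space W : Prop :=
  forall M N, M \in W -> N \in W -> comm_mx M N.

Definition all_diagonalizable W : Prop :=
  forall M, M \in W -> diagonalizable M.

(* The analogue, for a subspace, of codiagonalizable, which is stated for
   finite sequences of matrices. *)
Definition simultaneously_diagonalizable W : Prop :=
  exists2 P : 'M[K]_n, P \in unitmx &
    forall M, M \in W -> diagonalizable_for P M.

Definition commutativity_property V : Prop :=
  exists A, [/\ A \in V, A \in unitmx & commuting_space (lquot A V)].

Definition diagonalisability_property V : Prop :=
  exists B, [/\ B \in V, B \in unitmx & all_diagonalizable (lquot B V)].

End MatrixSubspaces.

(* Main.v *)
(** A commuting space [W] stays commuting when it is replaced by [U^-1 W] for an
    invertible [U] in [W], and likewise for simultaneous diagonalisability. As
    [B^-1 V = (A^-1 B)^-1 (A^-1 V)] and [A^-1 B] lies in [A^-1 V], whether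
    [A^-1 V] has either property does not depend on the invertible [A] in [V].
    Finally, a space is simultaneously diagonalisable exactly when it is
    commuting and consists of diagonalisable matrices: it is enough to
    diagonalise the finitely many matrices of a basis. *)

Require Import Defs.
From mathcomp Require Import all_boot all_order all_algebra.
From mathcomp Require Import reals complex.
(* [mxred] shadows the [conjmx] of [mxpoly], which is the one underlying
   [diagonalizable_for]. *)
From mathcomp Require Import mxpoly.

Set Implicit Arguments.
Unset Strict Implicit.
Unset Printing Implicit Defensive.

Import GRing.Theory.
Local Open Scope ring_scope.

Lemma span_sub_submod_closed (K : fieldType) (vT : vectType K) (S : {pred vT})
    (X : seq vT) :
  submod_closed S -> {subset X <= S} -> {subset <<X>>%VS <= S}.
Proof.
move=> [S0 S_lin] sXS v /(coord_span (X := in_tuple X)) ->.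
by elim/big_rec: _ => // i u _ Su; apply: S_lin => //; apply/sXS/mem_nth.
Qed.

Lemma is_diag_mxM (R : pzSemiRingType) n (A B : 'M[R]_n) :
  is_diag_mx A -> is_diag_mx B -> is_diag_mx (A *m B).
Proof.
by move=> /diag_mxP[a ->] /diag_mxP[b ->]; rewrite mulmx_diag diag_mx_is_diag.
Qed.

Section InverseMatrices.
Variables (R : comUnitRingType) (n : nat).
Implicit Types A B : 'M[R]_n.

Lemma invmxM A B : A \in unitmx -> B \in unitmx ->
  invmx (A *m B) = invmx B *m invmx A.
Proof. by case: n A B => [|m] A B; [rewrite !thinmx0 | apply: invrM]. Qed.

Lemma comm_mxV A B : comm_mx A B -> comm_mx A (invmx B).
Proof.
case: n A B => [|m] A B; last exact: commrV.
by rewrite [A]thinmx0 => _; apply: comm0mx.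
Qed.

Lemma invmx_diag (d : 'rV[R]_n) : diag_mx d \in unitmx ->
  invmx (diag_mx d) = diag_mx (map_mx GRing.inv d).
Proof.
move=> ud; apply: (can_inj (mulKmx ud)); rewrite mulmxV // mulmx_diag.
rewrite -diag_const_mx; congr diag_mx; apply/rowP => j; rewrite !mxE divrr //.
by move: ud; rewrite unitmxE det_diag => /unitr_prodP; apply.
Qed.

Lemma is_diag_mxV A : is_diag_mx A -> is_diag_mx (invmx A).
Proof.
have [uA | /invmx_out-> //] := boolP (A \in unitmx).
by move=> /diag_mxP[d eA]; rewrite eA invmx_diag -?eA ?diag_mx_is_diag.
Qed.

End InverseMatrices.

Section DiagonalizableFor.
Variable K : fieldType.

Lemma conjmxV n (P A : 'M[K]_n) : P \in unitmx -> A \in unitmx ->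
  conjmx P (invmx A) = invmx (conjmx P A).
Proof.
move=> uP uA; rewrite !conjumx // !invmxM ?unitmx_mul ?unitmx_inv ?uP //.
by rewrite invmxK mulmxA.
Qed.

Lemma diagonalizable_for_submod_closed m n (P : 'M[K]_(m, n)) :
  submod_closed [pred A | diagonalizable_for P A].
Proof.
split=> [|a A B]; rewrite !inE.
  by rewrite /simmx_to_for conjmx0 mx0_is_diag.
move=> /diagonalizable_forPex[d /eqP Ad] /diagonalizable_forPex[e /eqP Be].
apply/diagonalizable_forPex; exists (a *: d + e); apply/eqP.
by rewrite linearP /= -Ad -Be /conjmx mulmxDr mulmxDl -scalemxAr -scalemxAl.
Qed.

Lemma diagonalizable_forM m n (P : 'M[K]_(m, n)) (A B : 'M[K]_n) :
  stablemx P A -> stablemx P B ->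
  diagonalizable_for P A -> diagonalizable_for P B ->
  diagonalizable_for P (A *m B).
Proof.
by move=> sA sB; rewrite /simmx_to_for conjmxM //; apply: is_diag_mxM.
Qed.

Lemma diagonalizable_forV n (P A : 'M[K]_n) : P \in unitmx ->
  diagonalizable_for P A -> diagonalizable_for P (invmx A).
Proof.
have [uA uP | /invmx_out-> //] := boolP (A \in unitmx).
by rewrite /simmx_to_for conjmxV //; apply: is_diag_mxV.
Qed.

End DiagonalizableFor.

Section MatrixSpaces.
Variables (K : fieldType) (n : nat).
Implicit Types (A B M N U : 'M[K]_n) (V W : {vspace 'M[K]_n}).

Lemma simultaneously_diagonalizable_vbasis W :
  simultaneously_diagonalizable W <-> codiagonalizable (vbasis W).
Proof.
split=> -[P uP dP]; exists P => //.
  by apply/allP => M /vbasis_mem/dP.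
have /span_sub_submod_closed dW := diagonalizable_for_submod_closed P.
by move=> M; rewrite -(span_basis (vbasisP W)); apply: dW; apply/allP.
Qed.

Lemma simultaneously_diagonalizableP W :
  commuting_space W /\ all_diagonalizable W <-> simultaneously_diagonalizable W.
Proof.
split=> [[cW dW] | [P uP dP]].
  apply/simultaneously_diagonalizable_vbasis/codiagonalizableP.
  split=> [M N /vbasis_mem MW /vbasis_mem NW | M /vbasis_mem MW].
    exact: cW.
  exact: dW.
split=> [M N MW NW | M MW]; last by exists P; last exact: dP.
have /codiagonalizableP[cMN _] : codiagonalizable [:: M; N].
  by exists P; rewrite /= ?dP.
by apply: cMN; rewrite !inE eqxx ?orbT.
Qed.

Lemma mem_lquotP A V N :
  reflect (exists2 M, M \in V & N = invmx A *m M) (N \in lquot A V).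
Proof. by apply: (iffP memv_imgP) => -[M MV ->]; exists M; rewrite ?lfunE. Qed.

Lemma mem_lquot A V M : M \in V -> invmx A *m M \in lquot A V.
Proof. by move=> MV; apply/mem_lquotP; exists M. Qed.

Lemma lquotM A B V : A \in unitmx -> B \in unitmx ->
  lquot (A *m B) V = lquot B (lquot A V).
Proof.
move=> uA uB; rewrite /lquot -limg_comp; congr (_ @: _)%VS.
by apply/lfunP => M; rewrite comp_lfunE !lfunE /= invmxM // mulmxA.
Qed.

Lemma lquot_change_base (Q : {vspace 'M[K]_n} -> Prop) A B V :
  (forall U W, U \in W -> Q W -> Q (lquot U W)) ->
  A \in unitmx -> B \in unitmx -> B \in V ->
  Q (lquot A V) -> Q (lquot B V).
Proof.
move=> Q_lquot uA uB BV QA; rewrite -(mulKVmx uA B) lquotM //.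
  by apply: Q_lquot => //; apply: mem_lquot.
by rewrite unitmx_mul unitmx_inv uA.
Qed.

Lemma commuting_space_lquot U W :
  U \in W -> commuting_space W -> commuting_space (lquot U W).
Proof.
move=> UW cW _ _ /mem_lquotP[M MW ->] /mem_lquotP[N NW ->].
have cV L : L \in W -> comm_mx (invmx U) L.
  by move=> LW; apply/comm_mx_sym/comm_mxV/cW.
by apply: comm_mxM; apply/comm_mx_sym/comm_mxM;
  [| exact: cV | exact/comm_mx_sym/cV | exact: cW].
Qed.

Lemma simultaneously_diagonalizable_lquot U W :
  U \in W -> simultaneously_diagonalizable W ->
  simultaneously_diagonalizable (lquot U W).
Proof.
move=> UW [P uP dP]; exists P => // _ /mem_lquotP[M MW ->].
apply: diagonalizable_forM (dP M MW); rewrite ?stablemx_unit //.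
by apply/diagonalizable_forV/dP.
Qed.

End MatrixSpaces.

Theorem theorem2p7 (R : realType) (k : scalar_kind) (n : nat)
    (V : {vspace 'M[scalars R k]_n})
    (hV : nonsingular_space V)
    (hC : commutativity_property V) :
  diagonalisability_property V <->
  (forall A : 'M[scalars R k]_n, A \in V -> A \in unitmx ->
     simultaneously_diagonalizable (lquot A V)).
Proof.
split=> [[B [BV uB dB]] A AV uA | sdV].
  have cB : commuting_space (lquot B V).
    have [C [_ uC]] := hC.
    exact: (lquot_change_base (@commuting_space_lquot _ _) uC).
  have sdB : simultaneously_diagonalizable (lquot B V).
    exact/simultaneously_diagonalizableP.
  apply: lquot_change_base uB uA AV sdB.
  exact: simultaneously_diagonalizable_lquot.
have [B BV uB] := hV; exists B; split=> //.
by have /simultaneously_diagonalizableP[] := sdV B BV uB.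
Qed.
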